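(* Let $H_j := \sum_{i=1}^{j} \frac{1}{i}$ denote the $j$-th harmonic number and $\zeta(n) := \sum_{i=1}^\infty i^{-n}$ the Riemann zeta function. Then $$\sum_{j,k=1}^\infty \frac{H_j\,(H_{k+1}-1)}{j\,k\,(k+1)\,(j+k)} \;=\; -4\zeta(2) - 2\zeta(3) + 4\zeta(2)\zeta(3) + 2\zeta(5),$$ and this value equals $0.999222\ldots$.
   Context: $H_j$ is the $j$-th harmonic number and $\zeta$ is the Riemann zeta function. The double series is over all pairs of positive integers $j,k$. *)

(* Defs.v *)
From mathcomp Require Import all_boot all_order all_algebra.
From mathcomp Require Import all_classical all_reals all_analysis.

Set Implicit Arguments.
Unset Strict Implicit.
Unset Printing Implicit Defensive.

Import Order.TTheory GRing.Theory Num.Theory.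
Import numFieldNormedType.Exports.

Local Open Scope classical_set_scope.
Local Open Scope ring_scope.

Definition harmonic_number (R : realType) (j : nat) : R :=
  \sum_(1 <= i < j.+1) i%:R^-1.

(* [limn] has no meaningful value on a divergent series: intended for 1 < n. *)
Definition zeta (R : realType) (n : nat) : R :=
  limn (fun N : nat => \sum_(1 <= i < N.+1) (i%:R ^- n : R)).

(* Main.v *)
(* Let F_p(k) = e_p(1, 1/2, ..., 1/(k-1)) / k, where e_p is the elementary
   symmetric polynomial, and P_k = sum_{i <= j <= k} 1/(ij).  Summing over j
   first, sum_j H_j / (j (j+k)) = (zeta(2) + P_{k-1}) / k, so the series equals
     sum_k (zeta(2) + P_{k-1}) (H_k / k^2 - H_{k+1} / (k (k+1))).
   The second part gives - 4 zeta(2) - 2 zeta(3) by repeated summation by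
   parts.  In the first part sum_k H_k / k^2 = 2 zeta(3), and termwise
     H_k P_{k-1} / k^2 = F_1(k) P_k / k - F_2(k) / k^2 - F_1(k) / k^3.
   Here sum_k F_1(k) P_k / k = sum_{j,k} F_1(j) F_1(k) / (j+k); collecting the
   terms with j + k = m and using the convolution F_1 * F_1 = 6 F_3, this is
   6 sum_m F_3(m) / m.  The symmetric kernel m! n! / (m+n)! maps F_p to
   1/n^(p+1), which yields the duality
     sum_k F_p(k) / k^(q+1) = sum_k F_q(k) / k^(p+1),
   hence sum F_3(m) / m = zeta(5) and sum F_2(k) / k^2 = sum F_1(k) / k^3; the
   latter is the double zeta value zeta(4,1) = 2 zeta(5) - zeta(2) zeta(3). *)

Require Import Defs.
From mathcomp Require Import all_boot all_order all_algebra.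
From mathcomp Require Import all_classical all_reals all_analysis.
From mathcomp Require Import ring lra.

Set Implicit Arguments.
Unset Strict Implicit.
Unset Printing Implicit Defensive.

Import Order.TTheory GRing.Theory Num.Theory.
Import numFieldNormedType.Exports.

Local Open Scope classical_set_scope.
Local Open Scope ring_scope.

(** * Real series: interchange, summation by parts and antidiagonal sums *)

Variant has_sum {R : realType} (f : nat -> R) (l : R) : Prop :=
  HasSum of series f @ \oo --> l.

Section has_sum_theory.
Context {R : realType}.
Implicit Types (f g u x : nat -> R) (l m : R).

Lemma has_sum_unique f l m : has_sum f l -> has_sum f m -> l = m.
Proof. by move=> [fl] [fm]; exact: (cvg_unique _ fl fm). Qed.

Lemma eq_has_sum f g l : f =1 g -> has_sum f l -> has_sum g l.
Proof. by move=> /funext ->. Qed.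

Lemma has_sumD f g l m :
  has_sum f l -> has_sum g m -> has_sum (fun n => f n + g n) (l + m).
Proof.
move=> [fl] [gm]; split; rewrite [X in X @ _](_ : _ = series f \+ series g).
  exact: cvgD.
by apply/funext => n; rewrite /series /= big_split.
Qed.

Lemma has_sumZ c f l : has_sum f l -> has_sum (fun n => c * f n) (c * l).
Proof.
move=> [fl]; split; rewrite [X in X @ _](_ : _ = (fun n => c * series f n)).
  exact: cvgMl_tmp.
by apply/funext => n; rewrite /series /= mulr_sumr.
Qed.

Lemma has_sumB f g l m :
  has_sum f l -> has_sum g m -> has_sum (fun n => f n - g n) (l - m).
Proof.
move=> fl /(has_sumZ (-1)) gm; rewrite -mulN1r.
by apply: eq_has_sum (has_sumD fl gm) => n; rewrite mulN1r.
Qed.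

Lemma has_sumS f l : has_sum (fun n => f n.+1) l -> has_sum f (f 0%N + l).
Proof.
move=> [fl]; split; rewrite -cvg_shiftS.
rewrite [X in X @ _](_ : _ = (fun n => f 0%N + series (fun n => f n.+1) n)).
  by apply: cvgD fl; exact: cvg_cst.
by apply/funext => n; rewrite /series /= big_nat_recl.
Qed.

Lemma has_sum_behead f l : has_sum f l -> has_sum (fun n => f n.+1) (l - f 0%N).
Proof.
move=> [fl]; split; have fl' := fl; rewrite -cvg_shiftS in fl'.
rewrite [X in X @ _](_ : _ = (fun n => (series f) n.+1 - f 0%N)).
  by apply: cvgB => //; exact: cvg_cst.
by apply/funext => n; rewrite /series /= big_nat_recl// addrAC subrr add0r.
Qed.

Lemma has_sum_finite f N :
  (forall n, (N <= n)%N -> f n = 0) -> has_sum f (\sum_(0 <= i < N) f i).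
Proof.
move=> f0; split; apply: cvg_near_cst; exists N => // n /= Nn.
rewrite /series /= (@big_cat_nat _ _ _ N)//= [X in _ + X]big_nat_cond.
rewrite [X in _ + X]big1 ?addr0// => i /andP[/andP[+ _] _]; exact: f0.
Qed.

Lemma has_sum_telescope u :
  u @ \oo --> 0 -> has_sum (fun n => u n - u n.+1) (u 0%N).
Proof.
move=> u0; split; rewrite [X in X @ _](_ : _ = (fun n => u 0%N - u n)).
  by rewrite -[X in _ --> X]subr0; apply: cvgB => //; exact: cvg_cst.
apply/funext => n; rewrite /series /= -opprB -telescope_sumr// -sumrN.
by apply: eq_bigr => i _; rewrite opprB.
Qed.

(** Passage to the extended reals, where nonnegative double series may be interchanged
    unconditionally. *)
Lemma has_sum_EFin f l : (forall n, 0 <= f n) ->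
  has_sum f l <-> (\sum_(n <oo) (f n)%:E = l%:E)%E.
Proof.
move=> f0; split => [[fl]|fl].
  rewrite -(cvg_lim _ fl)// -EFin_lim; last by apply/cvg_ex; exists l.
  by congr (limn _); apply/funext => n; rewrite /= sumEFin.
have : (\sum_(0 <= n < N) (f n)%:E)%E @[N --> \oo] --> l%:E.
  by rewrite -fl; apply: is_cvg_nneseries => n _ _; rewrite lee_fin.
move/fine_cvgP => [_] fl'; split; move: fl'.
rewrite [X in X @ _ --> _ -> _](_ : _ = series f)//.
by apply/funext => n; rewrite /= sumEFin.
Qed.

Lemma has_sum_le f g m : (forall n, 0 <= f n) -> (forall n, f n <= g n) ->
  has_sum g m -> exists l, has_sum f l.
Proof.
move=> f0 fg [gm]; exists (limn (series f)); split.
apply: (@series_le_cvg _ f g) => //.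
  by move=> n; exact: le_trans (fg n).
by apply/cvg_ex; exists m.
Qed.

(** Tonelli's theorem: the interchange happens in the extended reals, so the convergence of the
    series of column sums is a conclusion. *)
Lemma has_sum_exchange (a : nat -> nat -> R) f g l :
  (forall i j, 0 <= a i j) -> (forall i, has_sum (a i) (f i)) ->
  (forall j, has_sum (a^~ j) (g j)) -> has_sum f l -> has_sum g l.
Proof.
move=> a0 af ag fl.
have s0 b m : (forall n, 0 <= b n) -> has_sum b m -> 0 <= m.
  move=> b0 bm; rewrite -lee_fin -(iffLR (has_sum_EFin _ b0) bm).
  by apply: nneseries_ge0 => n _ _; rewrite lee_fin.
have f0 i : 0 <= f i by exact: s0 (af i).
have g0 j : 0 <= g j by apply: s0 (ag j) => i.
apply/(has_sum_EFin _ g0); move/(has_sum_EFin _ f0): fl => <-.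
transitivity (\sum_(j <oo) \sum_(i <oo) (a i j)%:E)%E.
  apply: eq_eseriesr => j _; symmetry.
  exact: (iffLR (has_sum_EFin _ (a0^~ j))).
rewrite nneseries_interchange; last by move=> i j; rewrite lee_fin.
by apply: eq_eseriesr => i _; exact: (iffLR (has_sum_EFin _ (a0 i))).
Qed.

Lemma has_sum_shift f l N :
  has_sum f l -> has_sum (fun n => if (n < N)%N then 0 else f (n - N)%N) l.
Proof.
elim: N => [|N IHN] fl; first by apply: eq_has_sum fl => n; rewrite subn0.
by rewrite -[l]add0r; apply: has_sumS; apply: eq_has_sum (IHN fl) => n.
Qed.

(* Summation by parts, without boundary term: both sides are iterated sums of
   the nonnegative array [x i * (u n - u n.+1)], [i <= n]. *)
Lemma has_sum_abel x u l :
  (forall n, 0 <= x n) -> (forall n, u n.+1 <= u n) -> u @ \oo --> 0 ->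
  has_sum (fun n => x n * u n) l ->
  has_sum (fun n => (\sum_(0 <= i < n.+1) x i) * (u n - u n.+1)) l.
Proof.
move=> x0 udecr u0.
pose a i n := if (n < i)%N then 0 else x i * (u n - u n.+1).
apply: (@has_sum_exchange a).
- by move=> i n; rewrite /a; case: ifP => // _; rewrite mulr_ge0// subr_ge0.
- move=> i.
  have ui : (fun n => u (n + i)%N) @ \oo --> 0 by rewrite cvg_shiftn.
  have := has_sum_shift i (has_sumZ (x i) (has_sum_telescope ui)).
  apply: eq_has_sum => n; rewrite /a; case: ltnP => // ni.
  by rewrite addSn subnK.
- move=> n.
  have := @has_sum_finite (a^~ n) n.+1; rewrite mulr_suml /=.
  under eq_big_nat => i /andP[_ ni].
    rewrite /a ltnNge -ltnS ni /=; over.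
  by apply => i ni; rewrite /a ni.
Qed.

(** The term at [n = 0] vanishes and the others are those of [has_sum_abel] for [u] shifted by
    one. *)
Lemma has_sum_abel_strict x u l :
  (forall n, 0 <= x n) -> (forall n, u n.+1 <= u n) -> u @ \oo --> 0 ->
  has_sum (fun n => x n * u n.+1) l ->
  has_sum (fun n => (\sum_(0 <= i < n) x i) * (u n - u n.+1)) l.
Proof.
move=> x0 udecr u0 xu.
pose f n := (\sum_(0 <= i < n) x i) * (u n - u n.+1).
have /has_sumS : has_sum (fun n => f n.+1) l.
  by apply: (@has_sum_abel x (fun n => u n.+1)) => //; rewrite cvg_shiftS.
by rewrite {2}/f big_nil mul0r add0r.
Qed.

(** Shearing row [i] by [i] places turns antidiagonals into columns, so that summing along them
    becomes an exchange of rows and columns. *)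
Definition antidiagonal_array (a : nat -> nat -> R) i n : R :=
  if (n < i)%N then 0 else a i (n - i)%N.

Lemma has_sum_antidiagonal_array (a : nat -> nat -> R) n :
  has_sum (antidiagonal_array a ^~ n) (\sum_(0 <= i < n.+1) a i (n - i)%N).
Proof.
have := @has_sum_finite (antidiagonal_array a ^~ n) n.+1.
under eq_big_nat => i /andP[_ ni].
  rewrite /antidiagonal_array ltnNge -ltnS ni /=; over.
by apply => i ni; rewrite /antidiagonal_array ni.
Qed.

Lemma has_sum_antidiagonal (a : nat -> nat -> R) f l :
  (forall i j, 0 <= a i j) -> (forall i, has_sum (a i) (f i)) ->
  has_sum (fun n => \sum_(0 <= i < n.+1) a i (n - i)%N) l <-> has_sum f l.
Proof.
move=> a0 af.
have b0 i n : 0 <= antidiagonal_array a i n.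
  by rewrite /antidiagonal_array; case: ifP.
have bf i : has_sum (antidiagonal_array a i) (f i) by exact: has_sum_shift.
have ba := @has_sum_antidiagonal_array a.
split; last exact: (@has_sum_exchange (antidiagonal_array a)).
exact: (@has_sum_exchange (fun n i => antidiagonal_array a i n)).
Qed.

End has_sum_theory.

(** * Harmonic numbers and nested harmonic sums *)

Section harmonic_sums.
Context {R : realType}.
Local Notation r := (@harmonic R).

(* In all series below the index [n] stands for the positive integer [n.+1]. *)

Definition power_sum (s n : nat) : R := \sum_(0 <= i < n) r i ^+ s.

(* [nested_sum p n] is the sum of [1 / (i_1 * ... * i_p)] over
   [1 <= i_1 < ... < i_p <= n]. *)
Fixpoint nested_sum (p n : nat) : R :=
  if p is q.+1 then \sum_(0 <= i < n) nested_sum q i * r i else 1.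

Local Notation H := (nested_sum 1).

(* The sum of [1 / (i * j)] over [1 <= i <= j <= n]. *)
Definition star_sum (n : nat) : R := (H n ^+ 2 + power_sum 2 n) / 2.

Definition inverse_binomial (i j : nat) : R := i`!%:R * j`!%:R / (i + j)`!%:R.

Lemma harmonicE n : r n = (n%:R + 1)^-1.
Proof. by rewrite /= -natr1. Qed.

Lemma harmonic0 : r 0 = 1.
Proof. by rewrite /= invr1. Qed.

Lemma harmonicn_gt0 n : 0 < r n.
Proof. by rewrite /= invr_gt0. Qed.

Lemma harmonicn_ge0 n : 0 <= r n.
Proof. exact: ltW (harmonicn_gt0 n). Qed.

Lemma harmonicn_le1 n : r n <= 1.
Proof. by rewrite /= invf_le1// ler1n. Qed.

Lemma harmonic_decr n : r n.+1 <= r n.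
Proof. by rewrite /= lef_pV2 ?posrE// ler_nat. Qed.

Lemma harmonic_shift_cvg k : (fun n => r (n + k)%N) @ \oo --> 0.
Proof. by rewrite cvg_shiftn; exact: cvg_harmonic. Qed.

(** Partial fractions 1/(ab) = (1/a + 1/b)/(a + b) for a = m + 1 and b = n + 1; the index of 1/(a +
    b) is therefore [(m + n).+1]. *)
Lemma harmonic_mul m n : r m * r n = (r m + r n) * r (m + n).+1.
Proof.
rewrite !harmonicE -natr1 natrD.
have m0 := ler0n R m; have n0 := ler0n R n.
by field; rewrite !lt0r_neq0//; lra.
Qed.

Lemma power_sumS s n : power_sum s n.+1 = power_sum s n + r n ^+ s.
Proof. by rewrite /power_sum big_nat_recr. Qed.

Lemma power_sum_ge0 s n : 0 <= power_sum s n.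
Proof. by apply: sumr_ge0 => i _; rewrite exprn_ge0// harmonicn_ge0. Qed.

Lemma nested_sumS p n :
  nested_sum p.+1 n.+1 = nested_sum p.+1 n + nested_sum p n * r n.
Proof. by rewrite /= big_nat_recr. Qed.

Lemma nested_sum0 p : nested_sum p.+1 0 = 0.
Proof. by rewrite /= big_nil. Qed.

Lemma nested_sum_ge0 p n : 0 <= nested_sum p n.
Proof.
elim: p n => [|p IHp] n /=; first exact: ler01.
by apply: sumr_ge0 => i _; rewrite mulr_ge0// harmonicn_ge0.
Qed.

Lemma nested_sum1S n : H n.+1 = H n + r n.
Proof. by rewrite nested_sumS /= mul1r. Qed.

Lemma sum_harmonic n : \sum_(0 <= i < n) r i = H n.
Proof. by apply: eq_bigr => i _; rewrite /= mul1r. Qed.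

Local Arguments harmonic {R} n : simpl never.
Local Arguments nested_sum : simpl never.

(** Newton's identity for e_2; it makes [nested_sum 2] comparable with [star_sum]. *)
Lemma nested_sum2E n : nested_sum 2 n = (H n ^+ 2 - power_sum 2 n) / 2.
Proof.
elim: n => [|n IHn].
  by rewrite !nested_sum0 /power_sum big_nil expr0n subrr mul0r.
by rewrite nested_sumS IHn nested_sum1S power_sumS; field.
Qed.

Lemma star_sum0 : star_sum 0 = 0.
Proof.
by rewrite /star_sum nested_sum0 /power_sum big_nil expr0n addr0 mul0r.
Qed.

Lemma star_sumS n : star_sum n.+1 = star_sum n + H n.+1 * r n.
Proof. by rewrite /star_sum nested_sum1S power_sumS; field. Qed.

Lemma has_sum_zeta s : has_sum (fun n => r n ^+ s.+2) (zeta R s.+2).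
Proof.
have [l rl] : exists l, has_sum (fun n => r n ^+ s.+2) l.
  (* The majorant of 1/k^2 is 1 for k = 1 and 1/(k-1) - 1/k afterwards, which telescopes. *)
  pose g n := if n is m.+1 then r (m + 0)%N - r (m.+1 + 0)%N else 1.
  have /(@has_sumS _ g) := has_sum_telescope (harmonic_shift_cvg 0).
  apply: has_sum_le => n; first by rewrite exprn_ge0// harmonicn_ge0.
  apply: (@le_trans _ _ (r n ^+ 2)).
    by rewrite ler_wiXn2l// ?harmonicn_ge0// harmonicn_le1.
  case: n => [|n]; first by rewrite harmonic0 expr1n.
  have n0 := ler0n R n.
  rewrite /g !addn0 !harmonicE -natr1 -subr_ge0.
  rewrite (_ : _ - _ = ((n%:R + 1) * (n%:R + 1 + 1) ^+ 2)^-1).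
    by rewrite invr_ge0 mulr_ge0// ?sqr_ge0//; lra.
  by field; rewrite !lt0r_neq0//; lra.
suff -> : zeta R s.+2 = l by [].
apply: cvg_lim => //; case: rl.
rewrite [X in X @ _ --> _ -> _](_ : _ =
  (fun N : nat => \sum_(1 <= i < N.+1) (i%:R ^- s.+2 : R)))//.
apply/funext => N; rewrite /series /= big_add1 /=.
by apply: eq_bigr => i _; rewrite /harmonic /= exprVn.
Qed.

(** * Inner sums against the kernel 1/(j (j+k)) *)

Lemma has_sum_harmonic_diff k : has_sum (fun n => r n - r (n + k)%N) (H k).
Proof.
elim: k => [|k IHk].
  rewrite nested_sum0; have := @has_sum_finite R (fun=> 0) 0.
  rewrite big_nil => /(_ (fun _ _ => erefl)).
  by apply: eq_has_sum => n; rewrite addn0 subrr.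
rewrite nested_sum1S.
have := has_sumD IHk (has_sum_telescope (harmonic_shift_cvg k)).
by rewrite add0n; apply: eq_has_sum => n; rewrite addSn addnS; ring.
Qed.

Lemma harmonic_kernel n m : r n * r (n + m).+1 = r m * (r n - r (n + m.+1)%N).
Proof.
rewrite addnS !harmonicE -natr1 natrD.
have m0 := ler0n R m; have n0 := ler0n R n.
by field; rewrite !lt0r_neq0//; lra.
Qed.

Lemma has_sum_kernel m : has_sum (fun n => r n * r (n + m).+1) (r m * H m.+1).
Proof.
apply: eq_has_sum (has_sumZ (r m) (has_sum_harmonic_diff m.+1)) => n.
by rewrite harmonic_kernel.
Qed.

(** Induction on [k]: summation by parts turns the increment into the series of [has_sum_kernel],
    whose sum is exactly the increment of [star_sum]. *)
Lemma has_sum_nested_diff k :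
  has_sum (fun n => H n * (r n - r (n + k)%N)) (star_sum k).
Proof.
elim: k => [|k IHk].
  rewrite star_sum0; have := @has_sum_finite R (fun=> 0) 0.
  rewrite big_nil => /(_ (fun _ _ => erefl)).
  by apply: eq_has_sum => n; rewrite addn0 subrr mulr0.
rewrite star_sumS mulrC.
have : has_sum (fun n => (\sum_(0 <= i < n) r i) *
    (r (n + k)%N - r (n.+1 + k)%N)) (r k * H k.+1).
  apply: (has_sum_abel_strict (u := fun n => r (n + k)%N)).
  - exact: harmonicn_ge0.
  - by move=> n; exact: harmonic_decr.
  - exact: harmonic_shift_cvg.
  - exact: has_sum_kernel.
move/(has_sumD IHk); apply: eq_has_sum => n.
by rewrite sum_harmonic addSn addnS; ring.
Qed.

Lemma has_sum_nested_kernel m :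
  has_sum (fun n => H n * r n * r (n + m).+1) (r m * star_sum m.+1).
Proof.
apply: eq_has_sum (has_sumZ (r m) (has_sum_nested_diff m.+1)) => n.
by rewrite -mulrA harmonic_kernel; ring.
Qed.

Lemma has_sum_square_kernel m :
  has_sum (fun n => r n ^+ 2 * r (n + m).+1)
    (r m * zeta R 2 - r m ^+ 2 * H m.+1).
Proof.
rewrite expr2 -mulrA -mulrBr.
have := has_sumZ (r m) (has_sumB (has_sum_zeta 0) (has_sum_kernel m)).
apply: eq_has_sum => n.
rewrite !harmonicE -natr1 natrD.
have m0 := ler0n R m; have n0 := ler0n R n.
by field; rewrite !lt0r_neq0//; lra.
Qed.

(** Split H_j = H_{j-1} + 1/j. The negative term from the squares cancels the last increment of
    [star_sum m.+1], which leaves P_{k-1} for k = m + 1. *)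
Lemma has_sum_harmonic_kernel m :
  has_sum (fun n => H n.+1 * r n * r (n + m).+1)
    (r m * (zeta R 2 + star_sum m)).
Proof.
rewrite (_ : r m * _ = r m * star_sum m.+1 +
  (r m * zeta R 2 - r m ^+ 2 * H m.+1)); last by rewrite star_sumS; ring.
have := has_sumD (has_sum_nested_kernel m) (has_sum_square_kernel m).
by apply: eq_has_sum => n; rewrite nested_sum1S; ring.
Qed.

(** * Duality through inverse binomial coefficients *)

Lemma inverse_binomialC i j : inverse_binomial i j = inverse_binomial j i.
Proof. by rewrite /inverse_binomial addnC [_ * _`!%:R]mulrC. Qed.

Lemma inverse_binomial_ge0 i j : 0 <= inverse_binomial i j.
Proof. by rewrite /inverse_binomial divr_ge0 ?mulr_ge0. Qed.

(** Weighted by [r i], the kernel is a difference in [i]: this gives both its monotonicity in [i]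
    and the telescoping below. *)
Lemma inverse_binomialS i j :
  r i * inverse_binomial i.+1 j.+1 =
  r j * inverse_binomial i j.+1 - r j * inverse_binomial i.+1 j.+1.
Proof.
rewrite /inverse_binomial addSn !factS addnS !natrM !harmonicE -!natr1 natrD.
have i0 := ler0n R i; have j0 := ler0n R j.
by field; rewrite !lt0r_neq0 ?ltr0n ?fact_gt0//; lra.
Qed.

(** Equality holds at [j = 0], and the kernel decreases in [j]. *)
Lemma inverse_binomial_le i j : inverse_binomial i j.+1 <= r i.
Proof.
elim: j => [|j IHj].
  rewrite /inverse_binomial addn1 [i.+1`!]factS natrM mulr1 invfM mulrCA.
  by rewrite mulfV ?mulr1// pnatr_eq0 -lt0n fact_gt0.
apply: le_trans IHj; rewrite /inverse_binomial addnS !factS !natrM.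
have f0 k : 0 < k`!%:R :> R by rewrite ltr0n fact_gt0.
rewrite ler_pdivrMr ?mulr_gt0// mulrAC ler_pdivlMr// -subr_ge0.
rewrite (_ : _ - _ = i%:R * (i`!%:R * (j.+1)`!%:R * (i + j.+1)`!%:R)).
  by rewrite !mulr_ge0.
by rewrite factS !natrM -!natr1 natrD; ring.
Qed.

Lemma inverse_binomial_cvg j : inverse_binomial ^~ j.+1 @ \oo --> 0.
Proof.
apply: (@squeeze_cvgr _ _ _ _ (fun=> 0) r).
- by apply: nearW => i; rewrite inverse_binomial_ge0 inverse_binomial_le.
- exact: cvg_cst.
- exact: cvg_harmonic.
Qed.

(** The case [p = 0] telescopes; each summation by parts lowers the nesting by one and releases a
    factor [r j]. *)
Lemma has_sum_inverse_binomial p j :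
  has_sum (fun i => nested_sum p i * r i * inverse_binomial i.+1 j.+1)
    (r j ^+ p.+1).
Proof.
have u0 : (fun i => r j * inverse_binomial i j.+1) @ \oo --> 0.
  by rewrite -(mulr0 (r j)); apply: cvgMl_tmp; exact: inverse_binomial_cvg.
have udecr i :
    r j * inverse_binomial i.+1 j.+1 <= r j * inverse_binomial i j.+1.
  rewrite -subr_ge0 -inverse_binomialS.
  by rewrite mulr_ge0 ?inverse_binomial_ge0 ?harmonicn_ge0.
elim: p => [|p IHp].
  have := has_sum_telescope u0.
  rewrite (_ : inverse_binomial 0 _ = 1) ?mulr1; last first.
    by rewrite /inverse_binomial fact0 mul1r mulfV// pnatr_eq0 -lt0n fact_gt0.
  by apply: eq_has_sum => i; rewrite -inverse_binomialS mul1r.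
have := has_sum_abel_strict (x := fun i => nested_sum p i * r i) _ udecr u0.
move=> /(_ (r j ^+ p.+2)) A.
apply: eq_has_sum (A _ _) => [i|i|].
- by rewrite -inverse_binomialS mulrA.
- by rewrite mulr_ge0 ?nested_sum_ge0 ?harmonicn_ge0.
- by rewrite exprS; apply: eq_has_sum (has_sumZ (r j) IHp) => i; ring.
Qed.

(* Duality, by the symmetry of the kernel [inverse_binomial]. *)
Lemma has_sum_dual p q l :
  has_sum (fun n => nested_sum p n * r n * r n ^+ q.+1) l ->
  has_sum (fun n => nested_sum q n * r n * r n ^+ p.+1) l.
Proof.
pose a i j := (nested_sum p i * r i) *
  (nested_sum q j * r j * inverse_binomial j.+1 i.+1).
apply: (@has_sum_exchange R a) => [i j|i|j].
- by rewrite /a !mulr_ge0 ?nested_sum_ge0 ?inverse_binomial_ge0 ?harmonicn_ge0.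
- exact: has_sumZ (has_sum_inverse_binomial q i).
- apply: eq_has_sum (has_sumZ _ (has_sum_inverse_binomial p j)) => i.
  by rewrite /a inverse_binomialC; ring.
Qed.

(** * Multiple zeta values of weights three and five *)

Lemma has_sum_zeta21 : has_sum (fun n => H n * r n ^+ 2) (zeta R 3).
Proof.
have /(@has_sum_dual 0 1) : has_sum (fun n => 1 * r n * r n ^+ 2) (zeta R 3).
  by apply: eq_has_sum (has_sum_zeta 1) => n; rewrite mul1r -exprS.
by apply: eq_has_sum => n; ring.
Qed.

Lemma has_sum_zeta2111 :
  has_sum (fun n => nested_sum 3 n * r n ^+ 2) (zeta R 5).
Proof.
have /(@has_sum_dual 0 3) : has_sum (fun n => 1 * r n * r n ^+ 4) (zeta R 5).
  by apply: eq_has_sum (has_sum_zeta 3) => n; rewrite mul1r -exprS.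
by apply: eq_has_sum => n; ring.
Qed.

(** In the product of two partial sums, the pairs of indices are sorted into i < n, i > n and i = n.
    Keeping the three parts in one series avoids a separate convergence proof for each. *)
Lemma has_sum_stuffle :
  has_sum (fun n => power_sum 3 n * r n ^+ 2 + power_sum 2 n * r n ^+ 3
                    + r n ^+ 5) (zeta R 2 * zeta R 3).
Proof.
case: (has_sum_zeta 0) => z2; case: (has_sum_zeta 1) => z3; split.
rewrite [X in X @ _](_ : _ = (fun N => series (fun n => r n ^+ 2) N *
  series (fun n => r n ^+ 3) N)); first exact: cvgM.
apply/funext; rewrite /series; elim=> [|N IHN].
  by rewrite /= !big_nil mul0r.
rewrite /= big_nat_recr//= [X in X + _]IHN /= -!/(power_sum _ _) !power_sumS.
by ring.
Qed.

(* The partial fraction expansion of [1 / (k^3 (m - k) m)] turns the sum over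
   all [k < m] into double zeta values; summed over [m] first it is
   [zeta(4,1) + zeta(5)]. *)
Lemma has_sum_zeta41 :
  has_sum (fun n => H n * r n ^+ 4) (2 * zeta R 5 - zeta R 2 * zeta R 3).
Proof.
(* Convergence comes first: the unknown sum [a] occurs in both evaluations of the double series,
   which then give a linear equation for it. *)
have [a Ha] : exists a, has_sum (fun n => H n * r n ^+ 4) a.
  apply: has_sum_le has_sum_zeta21 => n.
    by rewrite mulr_ge0 ?nested_sum_ge0 ?exprn_ge0 ?harmonicn_ge0.
  rewrite ler_wpM2l ?nested_sum_ge0//.
  by rewrite ler_wiXn2l ?harmonicn_ge0 ?harmonicn_le1.
suff -> : 2 * zeta R 5 - zeta R 2 * zeta R 3 = a by [].
pose b i j := r i ^+ 3 * (r j * r (j + i).+1).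
have b0 i j : 0 <= b i j.
  by rewrite mulr_ge0 ?exprn_ge0 ?mulr_ge0 ?harmonicn_ge0.
have rows : has_sum (fun i => r i ^+ 3 * (r i * H i.+1)) (a + zeta R 5).
  apply: eq_has_sum (has_sumD Ha (has_sum_zeta 3)) => n.
  by rewrite nested_sum1S; ring.
have := has_sum_antidiagonal (a + zeta R 5) b0
  (fun i => has_sumZ _ (has_sum_kernel i)).
case=> _ /(_ rows).
(* [g n] is the sum over k < m of 1/(k^3 (m-k) m) for m = n + 1. Antidiagonal [N] has m = N + 2,
   hence the shift to [g n.+1]; the missing [g 0] is zero. *)
pose g n := power_sum 3 n * r n ^+ 2 + power_sum 2 n * r n ^+ 3
  + 2 * (H n * r n ^+ 4).
move/(@eq_has_sum _ _ (fun n => g n.+1)) => S.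
have /has_sumS : has_sum (fun n => g n.+1) (a + zeta R 5).
  apply: S => N.
  transitivity (\sum_(0 <= i < N.+1) (r N.+1 ^+ 2 * r i ^+ 3
     + r N.+1 ^+ 3 * r i ^+ 2 + r N.+1 ^+ 4 * r i
     + r N.+1 ^+ 4 * r (N - i)%N)).
    apply: eq_big_nat => i /andP[_ iN].
    have := harmonic_mul i (N - i); rewrite /b subnK ?subnKC//.
    move: (r i) (r (N - i)%N) (r N.+1) => x y z xyz.
    have -> : x ^+ 3 * (y * z) = x ^+ 2 * (x * y) * z by ring.
    have -> : x ^+ 2 * (x * y) * z = x ^+ 3 * z ^+ 2 + x * (x * y) * z ^+ 2.
      by rewrite {1}xyz; ring.
    have -> : x * (x * y) * z ^+ 2 = x ^+ 2 * z ^+ 3 + (x * y) * z ^+ 3.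
      by rewrite {1}xyz; ring.
    by rewrite xyz; ring.
  rewrite 3!big_split /= -!mulr_sumr.
  have -> : \sum_(0 <= i < N.+1) r (N - i)%N = H N.+1.
    rewrite -sum_harmonic [RHS]big_nat_rev.
    by apply: eq_bigr => i _; rewrite add0n subSS.
  by rewrite sum_harmonic -!/(power_sum _ _) /g; ring.
rewrite {2}/g nested_sum0 /power_sum !big_nil !mul0r mulr0 !add0r.
move/has_sumB => /(_ _ _ (has_sumZ 2 Ha)) G.
have Z := has_sumB has_sum_stuffle (has_sum_zeta 3).
have : a + zeta R 5 - 2 * a = zeta R 2 * zeta R 3 - zeta R 5.
  by apply: has_sum_unique G (eq_has_sum _ Z) => n; rewrite /g; ring.
by move=> E; apply/eqP; rewrite -subr_eq0; apply/eqP; lra.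
Qed.

(** zeta(3,1,1) is dual to zeta(4,1), with [p = 1] and [q = 2]. *)
Lemma has_sum_zeta311 :
  has_sum (fun n => nested_sum 2 n * r n ^+ 3)
    (2 * zeta R 5 - zeta R 2 * zeta R 3).
Proof.
have /(@has_sum_dual 1 2) : has_sum (fun n => H n * r n * r n ^+ 3)
    (2 * zeta R 5 - zeta R 2 * zeta R 3).
  by apply: eq_has_sum has_sum_zeta41 => n; ring.
by apply: eq_has_sum => n; ring.
Qed.

(** * Convolutions of the sequences F_p *)

Definition convolution (p q N : nat) : R :=
  \sum_(0 <= i < N.+1) (nested_sum p i * r i) *
                       (nested_sum q (N - i) * r (N - i)%N).

(** One of the two parts of F_p * F_q at k + l = N + 2 produced by 1/(kl) = (1/k + 1/l)/(k + l).
    Without the factor 1/l, its increment in [N] is again a convolution. *)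
Definition half_convolution (p q N : nat) : R :=
  \sum_(0 <= i < N.+1) nested_sum p i * r i * nested_sum q (N - i).

Lemma convolutionE p q N :
  convolution p q N =
  r N.+1 * (half_convolution p q N + half_convolution q p N).
Proof.
rewrite {2}/half_convolution big_nat_rev -big_split mulr_sumr /=.
apply: eq_big_nat => i /andP[_ iN]; rewrite add0n subSS subKn//.
have := harmonic_mul i (N - i); rewrite subnKC// => xyz.
transitivity (nested_sum p i * nested_sum q (N - i) * (r i * r (N - i)%N)).
  by ring.
by rewrite xyz; ring.
Qed.

Lemma half_convolution0 p N : half_convolution p 0 N = nested_sum p.+1 N.+1.
Proof. by apply: eq_bigr => i _; rewrite mulr1. Qed.

(** The new term [i = N.+1] is zero, since [nested_sum q.+1 0 = 0]; the other terms grow by the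
    increments of [nested_sum q.+1]. *)
Lemma half_convolutionS p q N :
  half_convolution p q.+1 N.+1 = half_convolution p q.+1 N + convolution p q N.
Proof.
rewrite /half_convolution big_nat_recr//= subnn nested_sum0 mulr0 addr0.
rewrite -big_split /=; apply: eq_big_nat => i /andP[_ iN].
by rewrite subSn// nested_sumS; ring.
Qed.

(** Both sides vanish at [N = 0] and have the same increments. *)
Lemma half_convolution_sum p q s c :
  (forall N, convolution p q N = c * (nested_sum s.+1 N.+1 * r N.+1)) ->
  forall N, half_convolution p q.+1 N = c * nested_sum s.+2 N.+1.
Proof.
move=> pqs; elim=> [|N IHN].
  by rewrite /half_convolution big_nat1 subnn nested_sumS !nested_sum0; ring.
by rewrite half_convolutionS IHN pqs (nested_sumS s.+1 N.+1); ring.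
Qed.

(* [F_1 * F_1 = 6 F_3] for [F_p k = nested_sum p (k - 1) / k], the coefficients
   of [(- ln (1 - x)) ^ (p + 1) / (p + 1)!]. *)
Lemma convolution11 N : convolution 1 1 N = 6 * (nested_sum 3 N.+1 * r N.+1).
Proof.
(* The constants 2, 3 and 6 are the binomial coefficients C(2,1), C(3,1) and C(4,2) that arise on
   multiplying the divided powers of - ln (1 - x). *)
have c00 M : convolution 0 0 M = 2 * (nested_sum 1 M.+1 * r M.+1).
  by rewrite convolutionE !half_convolution0; ring.
have c10 M : convolution 1 0 M = 3 * (nested_sum 2 M.+1 * r M.+1).
  rewrite convolutionE half_convolution0 (half_convolution_sum c00); ring.
by rewrite convolutionE !(half_convolution_sum c10); ring.
Qed.

Lemma has_sum_nested_star :
  has_sum (fun n => H n * r n ^+ 2 * star_sum n.+1) (6 * zeta R 5).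
Proof.
pose b i j := (H i * r i) * (H j * r j * r (j + i).+1).
have b0 i j : 0 <= b i j.
  by rewrite !mulr_ge0 ?nested_sum_ge0 ?harmonicn_ge0.
have := has_sum_antidiagonal (6 * zeta R 5) b0
  (fun i => has_sumZ _ (has_sum_nested_kernel i)).
case=> A _; apply: eq_has_sum (A _) => [n|]; first by ring.
(* Antidiagonal [N] collects j + k = N + 2, so the series of F_3(m)/m enters without its first term,
   which is zero. *)
have := has_sum_behead has_sum_zeta2111; rewrite nested_sum0 mul0r subr0.
move/(has_sumZ 6); apply: eq_has_sum => N.
transitivity (r N.+1 * convolution 1 1 N); first by rewrite convolution11; ring.
rewrite mulr_sumr; apply: eq_big_nat => i /andP[_ iN].
by rewrite /b subnK//; ring.
Qed.

(** * Evaluation of the single series over k *)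

Lemma has_sum_harmonic_star :
  has_sum (fun n => H n.+1 * star_sum n * r n ^+ 2)
    (2 * zeta R 2 * zeta R 3 + 2 * zeta R 5).
Proof.
have := has_sumB (has_sumB has_sum_nested_star has_sum_zeta311) has_sum_zeta41.
rewrite [X in has_sum _ X](_ : _ = 2 * zeta R 2 * zeta R 3 + 2 * zeta R 5);
  last by ring.
apply: eq_has_sum => n.
by rewrite star_sumS nested_sum1S nested_sum2E /star_sum; field.
Qed.

Lemma has_sum_harmonic_square :
  has_sum (fun n => H n.+1 * r n ^+ 2) (2 * zeta R 3).
Proof.
have := has_sumD has_sum_zeta21 (has_sum_zeta 1); rewrite -mulr2n mulr_natl.
by apply: eq_has_sum => n; rewrite nested_sum1S; ring.
Qed.

Lemma has_sum_harmonic_consecutive :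
  has_sum (fun n => H n.+1 * r n * r n.+1) (zeta R 2).
Proof.
have := has_sum_harmonic_kernel 0; rewrite star_sum0 addr0 harmonic0 mul1r.
by apply: eq_has_sum => n; rewrite addn0.
Qed.

Lemma harmonic_consecutive n : r n - r n.+1 = r n * r n.+1.
Proof.
rewrite !harmonicE -natr1; have n0 := ler0n R n.
by field; rewrite !lt0r_neq0//; lra.
Qed.

Lemma has_sum_harmonic_product :
  has_sum (fun n => H n.+1 * H n.+2 * (r n * r n.+1)) (zeta R 2 + 2 * zeta R 3).
Proof.
(* This is H_{n+1} (H_{n+2} - H_n), so the partial sums of [x] are the products H_{n+1} H_{n+2}. *)
pose x n := H n.+1 * (r n + r n.+1).
have x0 n : 0 <= x n.
  by rewrite mulr_ge0 ?nested_sum_ge0 ?addr_ge0 ?harmonicn_ge0.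
have xr : has_sum (fun n => x n * r n) (zeta R 2 + 2 * zeta R 3).
  have := has_sumD has_sum_harmonic_consecutive has_sum_harmonic_square.
  by apply: eq_has_sum => n; rewrite /x; ring.
have := has_sum_abel x0 harmonic_decr (@cvg_harmonic R) xr.
apply: eq_has_sum => n; rewrite harmonic_consecutive; congr (_ * _).
elim: n => [|n IHn].
  by rewrite big_nat1 /x !nested_sum1S nested_sum0; ring.
by rewrite big_nat_recr//= IHn /x (nested_sum1S n.+2) (nested_sum1S n.+1); ring.
Qed.

(** H_k / k is the mean of the first k terms of a null sequence, so Cesaro's theorem applies. *)
Lemma harmonic_mean_cvg : (fun n => H n.+1 * r n) @ \oo --> 0.
Proof.
rewrite [X in X @ _](_ : _ = arithmetic_mean r).
  exact: cesaro (@cvg_harmonic R).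
by apply/funext => n; rewrite /arithmetic_mean /= mulrC -sum_harmonic.
Qed.

Lemma has_sum_lower_weight :
  has_sum (fun n => (zeta R 2 + star_sum n) * (H n.+2 * (r n * r n.+1)))
    (4 * zeta R 2 + 2 * zeta R 3).
Proof.
(* With k = n + 1, [D] is an antidifference of H_{k+1}/(k (k+1)). The sequence [x] has partial sums
   [zeta R 2 + star_sum n], its first entry supplying the constant. *)
pose D n := (H n.+1 + 1) * r n.
pose x n := if n is m.+1 then H m.+1 * r m else zeta R 2.
have DE n : D n - D n.+1 = H n.+2 * (r n * r n.+1).
  rewrite /D (nested_sum1S n.+1) !harmonicE -natr1; have n0 := ler0n R n.
  by field; rewrite !lt0r_neq0//; lra.
have Ddecr n : D n.+1 <= D n.
  by rewrite -subr_ge0 DE !mulr_ge0 ?nested_sum_ge0 ?harmonicn_ge0.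
have D0 : D @ \oo --> 0.
  rewrite [X in X @ _](_ : _ = (fun n => H n.+1 * r n) \+ r).
    by rewrite -[0]addr0; apply: cvgD harmonic_mean_cvg _; exact: cvg_harmonic.
  by apply/funext => n; rewrite /D /=; ring.
have z2_ge0 : 0 <= zeta R 2.
  case: (has_sum_zeta 0) => z2; rewrite -(cvg_lim _ z2)//.
  apply: limr_ge; first by apply/cvg_ex; exists (zeta R 2).
  by apply: nearW => n; exact: power_sum_ge0.
have x0 n : 0 <= x n.
  by case: n => [|n]; rewrite /x// mulr_ge0 ?nested_sum_ge0 ?harmonicn_ge0.
have xD : has_sum (fun n => x n * D n) (4 * zeta R 2 + 2 * zeta R 3).
  have -> : 4 * zeta R 2 + 2 * zeta R 3 =
      x 0%N * D 0%N + (zeta R 2 + 2 * zeta R 3 + zeta R 2).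
    by rewrite /x /D nested_sum1S nested_sum0 harmonic0; ring.
  apply: (@has_sumS _ (fun n => x n * D n)).
  have := has_sumD has_sum_harmonic_product has_sum_harmonic_consecutive.
  by apply: eq_has_sum => n; rewrite /x /D; ring.
have := has_sum_abel x0 Ddecr D0 xD; apply: eq_has_sum => n.
rewrite DE; congr (_ * _); elim: n => [|n IHn].
  by rewrite big_nat1 star_sum0 addr0.
by rewrite big_nat_recr//= IHn star_sumS /x; ring.
Qed.

(** With k = n + 1, (H_{k+1} - 1)/(k^2 (k+1)) = H_k/k^2 - H_{k+1}/(k (k+1)). *)
Lemma has_sum_total :
  has_sum
    (fun n => (H n.+2 - 1) * (r n * r n.+1) * (r n * (zeta R 2 + star_sum n)))
    (- 4 * zeta R 2 - 2 * zeta R 3 + 4 * zeta R 2 * zeta R 3 + 2 * zeta R 5).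
Proof.
have := has_sumB (has_sumD (has_sumZ (zeta R 2) has_sum_harmonic_square)
  has_sum_harmonic_star) has_sum_lower_weight.
rewrite [X in has_sum _ X](_ : _ = - 4 * zeta R 2 - 2 * zeta R 3
  + 4 * zeta R 2 * zeta R 3 + 2 * zeta R 5); last by ring.
apply: eq_has_sum => n.
rewrite (nested_sum1S n.+1) !harmonicE -natr1; have n0 := ler0n R n.
by field; rewrite !lt0r_neq0//; lra.
Qed.

Lemma harmonic_numberE n : harmonic_number R n = H n.
Proof. by rewrite -sum_harmonic /harmonic_number big_add1. Qed.

End harmonic_sums.

(** * Numerical bounds for zeta(2), zeta(3) and zeta(5) *)

Section zeta_bounds.
Context {R : realType}.

(** The partial sums corrected by [u] tend to [l] and are nonincreasing from [N] on, so their value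
    at [N] bounds [l]. *)
Lemma has_sum_le_tail (f u : nat -> R) l N :
  has_sum f l -> u @ \oo --> 0 ->
  (forall n, (N <= n)%N -> f n <= u n - u n.+1) ->
  l <= \sum_(0 <= i < N) f i + u N.
Proof.
move=> [fl] u0 fu; pose w n := series f (n + N)%N + u (n + N)%N.
have wl : w @ \oo --> l.
  by rewrite -[l]addr0; apply: cvgD; rewrite cvg_shiftn.
have wdecr : nonincreasing_seq w.
  apply/nonincreasing_seqP => n; rewrite /w addSn /series /= big_nat_recr//=.
  by rewrite -addrA lerD2l -lerBrDr fu// leq_addl.
rewrite -(cvg_lim _ wl)//; have := nonincreasing_cvgn_ge wdecr.
by move=> /(_ _ 0%N); rewrite /w add0n; apply; apply/cvg_ex; exists l.
Qed.

Lemma has_sum_ge_tail (f u : nat -> R) l N :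
  has_sum f l -> u @ \oo --> 0 ->
  (forall n, (N <= n)%N -> u n - u n.+1 <= f n) ->
  \sum_(0 <= i < N) f i + u N <= l.
Proof.
move=> fl u0 uf; rewrite -lerN2 opprD -sumrN.
apply: (@has_sum_le_tail (fun n => - f n) (fun n => - u n)).
- by rewrite -mulN1r; apply: eq_has_sum (has_sumZ (-1) fl) => n; rewrite mulN1r.
- by rewrite -oppr0; exact: cvgN.
- by move=> n Nn; rewrite -opprD lerN2 uf.
Qed.

Lemma cvg_inv_pow k : (fun n : nat => n%:R ^- k.+1 : R) @ \oo --> 0.
Proof.
have t0 : (fun n : nat => n%:R^-1 : R) @ \oo --> 0.
  by rewrite -cvg_shiftS; exact: cvg_harmonic.
elim: k => [|k IHk]; first by under eq_fun do rewrite expr1.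
rewrite -(mulr0 0); under eq_fun do rewrite exprS invfM.
exact: cvgM.
Qed.

(** One shape for all tail corrections [u] below; shorter ones are padded with zero coefficients. *)
Lemma cvg_inv_pow_comb (a b c d : R) i j k l :
  (fun n : nat => a * n%:R ^- i.+1 + b * n%:R ^- j.+1 + c * n%:R ^- k.+1
    + d * n%:R ^- l.+1) @ \oo --> 0.
Proof.
have -> : 0 = a * 0 + b * 0 + c * 0 + d * 0 :> R by rewrite !mulr0 !addr0.
by do 3?apply: cvgD; apply: cvgMl_tmp; exact: cvg_inv_pow.
Qed.

Lemma zeta_le_tail s (u : R -> R) N : (fun n : nat => u n%:R) @ \oo --> 0 ->
  (forall x, N%:R <= x -> (x + 1) ^- s.+2 <= u x - u (x + 1)) ->
  zeta R s.+2 <= \sum_(0 <= i < N) harmonic i ^+ s.+2 + u N%:R.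
Proof.
move=> u0 fu; apply: has_sum_le_tail (has_sum_zeta s) u0 _ => n Nn.
by rewrite harmonicE exprVn -[n.+1%:R]natr1 fu// ler_nat.
Qed.

Lemma zeta_ge_tail s (u : R -> R) N : (fun n : nat => u n%:R) @ \oo --> 0 ->
  (forall x, N%:R <= x -> u x - u (x + 1) <= (x + 1) ^- s.+2) ->
  \sum_(0 <= i < N) harmonic i ^+ s.+2 + u N%:R <= zeta R s.+2.
Proof.
move=> u0 uf; apply: has_sum_ge_tail (has_sum_zeta s) u0 _ => n Nn.
by rewrite harmonicE exprVn -[n.+1%:R]natr1 uf// ler_nat.
Qed.

(* The functions [u] below consist of the first terms of the Euler-Maclaurin
   expansion of the tail of the zeta series. *)
Lemma zeta2_bounds :
  1 + 64 / 10 ^+ 2 + 49 / 10 ^+ 4 + 34 / 10 ^+ 6 + 6 / 10 ^+ 8 <= zeta R 2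
    <= 1 + 64 / 10 ^+ 2 + 49 / 10 ^+ 4 + 34 / 10 ^+ 6 + 10 / 10 ^+ 8.
Proof.
apply/andP; split.
- pose u :=
    fun x : R => 1 * x ^- 1 + (- 2^-1) * x ^- 2 + 6^-1 * x ^- 3
      + (- 30^-1) * x ^- 5.
  have B := @zeta_ge_tail 0 u 16 (cvg_inv_pow_comb _ _ _ _ _ _ _ _).
  apply: le_trans _ (B _) => [|x x16].
    by rewrite !big_nat_recr//= big_nil /u; lra.
  rewrite -subr_ge0 (_ : _ - _ =
    (1 + 5 * x + 5 * x ^+ 2) / (30 * x ^+ 5 * (x + 1) ^+ 5));
    last first.
    by rewrite /u; field; rewrite !lt0r_neq0//; lra.
  by rewrite divr_ge0// ?addr_ge0 ?mulr_ge0 ?exprn_ge0//; lra.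
(* Dropping the negative term in [x ^- 5] reverses the direction of the estimate. *)
- pose u :=
    fun x : R => 1 * x ^- 1 + (- 2^-1) * x ^- 2 + 6^-1 * x ^- 3 + 0 * x ^- 5.
  have B := @zeta_le_tail 0 u 16 (cvg_inv_pow_comb _ _ _ _ _ _ _ _).
  apply: le_trans (B _) _ => [x x16|]; last first.
    by rewrite !big_nat_recr//= big_nil /u; lra.
  rewrite -subr_ge0 (_ : _ - _ =
    1 / (6 * x ^+ 3 * (x + 1) ^+ 3)); last first.
    by rewrite /u; field; rewrite !lt0r_neq0//; lra.
  by rewrite divr_ge0// ?addr_ge0 ?mulr_ge0 ?exprn_ge0//; lra.
Qed.

Lemma zeta3_bounds :
  1 + 20 / 10 ^+ 2 + 20 / 10 ^+ 4 + 56 / 10 ^+ 6 + 90 / 10 ^+ 8 <= zeta R 3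
    <= 1 + 20 / 10 ^+ 2 + 20 / 10 ^+ 4 + 56 / 10 ^+ 6 + 91 / 10 ^+ 8.
Proof.
apply/andP; split.
- pose u :=
    fun x : R => 2^-1 * x ^- 2 + (- 2^-1) * x ^- 3 + 4^-1 * x ^- 4
      + (- 12^-1) * x ^- 6.
  have B := @zeta_ge_tail 1 u 16 (cvg_inv_pow_comb _ _ _ _ _ _ _ _).
  apply: le_trans _ (B _) => [|x x16].
    by rewrite !big_nat_recr//= big_nil /u; lra.
  rewrite -subr_ge0 (_ : _ - _ =
    (1 + 6 * x + 12 * x ^+ 2 + 8 * x ^+ 3) / (12 * x ^+ 6 * (x + 1) ^+ 6));
    last first.
    by rewrite /u; field; rewrite !lt0r_neq0//; lra.
  by rewrite divr_ge0// ?addr_ge0 ?mulr_ge0 ?exprn_ge0//; lra.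
- pose u :=
    fun x : R => 2^-1 * x ^- 2 + (- 2^-1) * x ^- 3 + 4^-1 * x ^- 4 + 0 * x ^- 6.
  have B := @zeta_le_tail 1 u 16 (cvg_inv_pow_comb _ _ _ _ _ _ _ _).
  apply: le_trans (B _) _ => [x x16|]; last first.
    by rewrite !big_nat_recr//= big_nil /u; lra.
  rewrite -subr_ge0 (_ : _ - _ =
    (1 + 2 * x) / (4 * x ^+ 4 * (x + 1) ^+ 4));
    last first.
    by rewrite /u; field; rewrite !lt0r_neq0//; lra.
  by rewrite divr_ge0// ?addr_ge0 ?mulr_ge0 ?exprn_ge0//; lra.
Qed.

Lemma zeta5_bounds :
  1 + 3 / 10 ^+ 2 + 69 / 10 ^+ 4 + 27 / 10 ^+ 6 + 73 / 10 ^+ 8 <= zeta R 5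
    <= 1 + 3 / 10 ^+ 2 + 69 / 10 ^+ 4 + 27 / 10 ^+ 6 + 76 / 10 ^+ 8.
Proof.
apply/andP; split.
- pose u :=
    fun x : R => 4^-1 * x ^- 4 + (- 2^-1) * x ^- 5 + 0 * x ^- 6 + 0 * x ^- 6.
  have B := @zeta_ge_tail 3 u 16 (cvg_inv_pow_comb _ _ _ _ _ _ _ _).
  apply: le_trans _ (B _) => [|x x16].
    by rewrite !big_nat_recr//= big_nil /u; lra.
  rewrite -subr_ge0 (_ : _ - _ =
    (2 + 9 * x + 15 * x ^+ 2 + 10 * x ^+ 3) / (4 * x ^+ 5 * (x + 1) ^+ 5));
    last first.
    by rewrite /u; field; rewrite !lt0r_neq0//; lra.
  by rewrite divr_ge0// ?addr_ge0 ?mulr_ge0 ?exprn_ge0//; lra.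
- pose u :=
    fun x : R => 4^-1 * x ^- 4 + (- 2^-1) * x ^- 5 + (5 / 12) * x ^- 6
      + 0 * x ^- 6.
  have B := @zeta_le_tail 3 u 16 (cvg_inv_pow_comb _ _ _ _ _ _ _ _).
  apply: le_trans (B _) _ => [x x16|]; last first.
    by rewrite !big_nat_recr//= big_nil /u; lra.
  rewrite -subr_ge0 (_ : _ - _ =
    (5 + 24 * x + 42 * x ^+ 2 + 28 * x ^+ 3) / (12 * x ^+ 6 * (x + 1) ^+ 6));
    last first.
    by rewrite /u; field; rewrite !lt0r_neq0//; lra.
  by rewrite divr_ge0// ?addr_ge0 ?mulr_ge0 ?exprn_ge0//; lra.
Qed.

(** As - 4a + 4ab = 4a (b - 1) and b > 1, bounding [a] bounds this term. Once expanded, the products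
    [L] and [U] say so linearly in [a * b]. *)
Lemma value_bounds (a b c : R) :
  1 + 64 / 10 ^+ 2 + 49 / 10 ^+ 4 + 34 / 10 ^+ 6 + 6 / 10 ^+ 8 <= a
    <= 1 + 64 / 10 ^+ 2 + 49 / 10 ^+ 4 + 34 / 10 ^+ 6 + 10 / 10 ^+ 8 ->
  1 + 20 / 10 ^+ 2 + 20 / 10 ^+ 4 + 56 / 10 ^+ 6 + 90 / 10 ^+ 8 <= b
    <= 1 + 20 / 10 ^+ 2 + 20 / 10 ^+ 4 + 56 / 10 ^+ 6 + 91 / 10 ^+ 8 ->
  1 + 3 / 10 ^+ 2 + 69 / 10 ^+ 4 + 27 / 10 ^+ 6 + 73 / 10 ^+ 8 <= c
    <= 1 + 3 / 10 ^+ 2 + 69 / 10 ^+ 4 + 27 / 10 ^+ 6 + 76 / 10 ^+ 8 ->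
  999 / 10 ^+ 3 + 222 / 10 ^+ 6 <= - 4 * a - 2 * b + 4 * a * b + 2 * c
    < 999 / 10 ^+ 3 + 223 / 10 ^+ 6.
Proof.
move=> /andP[al au] /andP[bl bu] /andP[cl cu].
have L : 0 <= (a - (1 + 64 / 10 ^+ 2 + 49 / 10 ^+ 4 + 34 / 10 ^+ 6
    + 6 / 10 ^+ 8)) * (b - 1) by apply: mulr_ge0; lra.
have U : 0 <= (1 + 64 / 10 ^+ 2 + 49 / 10 ^+ 4 + 34 / 10 ^+ 6
    + 10 / 10 ^+ 8 - a) * (b - 1) by apply: mulr_ge0; lra.
move: L U; rewrite !mulrBl !mulrBr => L U.
by apply/andP; split; lra.
Qed.

End zeta_bounds.

(** * The double series as a sum over pairs *)

Lemma esum_positive_pairs (R : realType) (a : nat -> nat -> R) f l :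
  (forall i j, 0 <= a i j) -> (forall i, has_sum (a i) (f i)) -> has_sum f l ->
  (\esum_(p in [set p : nat * nat | (0 < p.1)%N /\ (0 < p.2)%N])
     (a p.2.-1 p.1.-1)%:E = l%:E)%E.
Proof.
move=> a0 af fl.
have f0 i : 0 <= f i.
  rewrite -lee_fin -(iffLR (has_sum_EFin _ (a0 i)) (af i)).
  by apply: nneseries_ge0 => n _ _; rewrite lee_fin.
(* The swap of components makes row [i] belong to k = i + 1, so that each row is a sum over j. *)
rewrite (reindex_esum [set: nat * nat] _ (fun p => (p.2.+1, p.1.+1)))/=;
  last first.
  split => [//|[i j] [i' j'] _ _ /= [-> ->]//|[i j] /= [i0 j0]].
  by exists (j.-1, i.-1) => //=; rewrite !prednK.
have -> : [set: nat * nat] = [set: nat] `*`` (fun=> [set: nat]).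
  by apply/seteqP; split.
rewrite -(esum_esum (a := fun i j => (a i j)%:E)); last first.
  by move=> i j _ _; rewrite lee_fin.
rewrite -(iffLR (has_sum_EFin _ f0) fl) nneseries_esumT; last first.
  by move=> n; rewrite lee_fin.
apply: eq_esum => i _; rewrite -nneseries_esumT; last first.
  by move=> n; rewrite lee_fin.
exact: (iffLR (has_sum_EFin _ (a0 i)) (af i)).
Qed.

Theorem theorem1 (R : realType) :
  let H : nat -> R := harmonic_number R in
  let z : nat -> R := zeta R in
  let value : R := - 4 * z 2%N - 2 * z 3%N + 4 * z 2%N * z 3%N + 2 * z 5%N in
  (\esum_(p in [set p : nat * nat | (0 < p.1)%N /\ (0 < p.2)%N])
     (H p.1 * (H p.2.+1 - 1)
        / (p.1%:R * p.2%:R * (p.2 + 1)%:R * (p.1 + p.2)%:R))%:E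
   = value%:E)%E
  /\ 999 / 10 ^+ 3 + 222 / 10 ^+ 6 <= value < 999 / 10 ^+ 3 + 223 / 10 ^+ 6.
Proof.
move=> H z value; split; last first.
  exact: value_bounds zeta2_bounds zeta3_bounds zeta5_bounds.
pose c i : R := (nested_sum 1 i.+2 - 1) * (harmonic i * harmonic i.+1).
pose a i j := c i * (nested_sum 1 j.+1 * harmonic j * harmonic (j + i).+1).
(* Nonnegativity amounts to H_{k+1} >= 1; it allows the sum over pairs to be computed row by row. *)
have c0 i : 0 <= c i.
  rewrite !mulr_ge0 ?harmonicn_ge0// subr_ge0.
  elim: i => [|i IHi].
    by rewrite !nested_sum1S nested_sum0 add0r harmonic0 lerDl harmonicn_ge0.
  by rewrite nested_sum1S (le_trans IHi)// lerDl harmonicn_ge0.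
rewrite -(esum_positive_pairs (a := a) _
  (fun i => has_sumZ (c i) (has_sum_harmonic_kernel i)) has_sum_total);
  last first.
  move=> i j; apply: mulr_ge0 => //.
  by rewrite !mulr_ge0 ?nested_sum_ge0 ?harmonicn_ge0.
apply: eq_esum => -[[|j] [|i]] /= [j0 i0] //; congr _%:E.
rewrite /a /c /H !harmonic_numberE addn1 addSn addnS.
by rewrite /harmonic /= !invfM; ring.
Qed.
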